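(* For all integers $k\ge 2$, \[\alpha_{1,k}\le \frac{k+\sqrt{k(4k-1)}}{3k-1}.\]
   Context: For a graph on $n$ vertices, $\lambda_1\ge\cdots\ge\lambda_n$ are the eigenvalues of its adjacency matrix. Let $\mathcal G_n$ be the family of simple graphs on $n$ vertices, with $\overline{G}$ the usual complement. For fixed positive integers $i,j$, \[\alpha_{i,j}=\lim_{n\to\infty}\frac1n\max_{G\in\mathcal G_n}\bigl(\lambda_i(G)+\lambda_j(\overline{G})\bigr),\] a limit which is known to exist (Nikiforov). *)

(* Defs.v *)
From HB Require Import structures.
From mathcomp Require Import all_boot all_order all_algebra.
From mathcomp Require Import polyrcf.
From mathcomp Require Import boolp reals filter topology normedtype sequences.

Set Implicit Arguments.
Unset Strict Implicit.
Unset Printing Implicit Defensive.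

Import Order.TTheory GRing.Theory Num.Theory.
Import numFieldNormedType.Exports.

Local Open Scope ring_scope.

(* A simple graph on the vertex set 'I_n, given by its set of edges. *)
Record sgraph (n : nat) := SGraph {
  edges : {set {set 'I_n}};
  _ : [forall e in edges, #|e| == 2%N]
}.

HB.instance Definition _ n := [isSub for @edges n].
HB.instance Definition _ n := [Finite of sgraph n by <:].

Definition all_pairs (n : nat) : {set {set 'I_n}} :=
  [set e : {set 'I_n} | #|e| == 2%N].

Lemma edgeless_subproof (n : nat) :
  [forall e in (set0 : {set {set 'I_n}}), #|e| == 2%N].
Proof. by apply/forall_inP => e; rewrite inE. Qed.

Definition edgeless (n : nat) : sgraph n := SGraph (edgeless_subproof n).

Lemma compl_subproof (n : nat) (G : sgraph n) :
  [forall e in all_pairs n :\: edges G, #|e| == 2%N].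
Proof. by apply/forall_inP => e; rewrite !inE => /andP[]. Qed.

Definition compl (n : nat) (G : sgraph n) : sgraph n :=
  SGraph (compl_subproof G).

(* The diagonal vanishes because [set i; i] is a singleton, never an edge. *)
Definition adjmx (R : realType) (n : nat) (G : sgraph n) : 'M[R]_n :=
  \matrix_(i, j) ([set i; j] \in edges G)%:R.

(* The real eigenvalues of A in nonincreasing order, each repeated according
   to its algebraic multiplicity. For a symmetric A there are exactly n. *)
Definition eigenvalues (R : realType) (n : nat) (A : 'M[R]_n) : seq R :=
  sort (fun x y => y <= x)
    (flatten [seq nseq (mup x (char_poly A)) x | x <- rootsR (char_poly A)]).

(* The i-th largest eigenvalue, counted from i = 1; it is 0 when i > n. *)
Definition lambda (R : realType) (i n : nat) (G : sgraph n) : R :=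
  nth 0 (eigenvalues (adjmx R G)) i.-1.

(* A maximum over the finite nonempty type [sgraph n]: the initial value is
   the one attained at the edgeless graph. *)
Definition max_sum (R : realType) (i j n : nat) : R :=
  \big[Num.max/lambda R i (edgeless n) + lambda R j (compl (edgeless n))]_(G : sgraph n)
     (lambda R i G + lambda R j (compl G)).

Definition alpha (R : realType) (i j : nat) : R :=
  limn (fun n : nat => n%:R^-1 * max_sum R i j n).

(* Main.v *)
(* Let A and B be the adjacency matrices of G and of its complement, lam =
   lambda_1(A), mu = lambda_k(B), x a unit eigenvector of A for lam, Y the span
   of k orthonormal eigenvectors of B for eigenvalues >= mu, and V = span(x, Y).
   We may assume lam + mu > n; then x is not in Y, so V has dimension k + 1. As
   A + B = J - I, the form of A is <= -mu on the unit vectors of Y orthogonal to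
   the all-one vector, so V has an orthonormal basis with A-diagonal (lam, k - 1
   entries <= -mu, a) and another one with B-diagonal (k entries >= mu, nu). The
   traces of A and B on V add up to at most n, which forces a + nu <=
   n - lam - mu in the extremal case, while the squares of all these diagonal
   entries add up to at most |A|^2 + |B|^2 <= n^2. Hence
     lam^2 + (2k - 1) mu^2 + (lam + mu - n)^2 / 2 <= n^2,
   and with t = lam + mu this gives (3k - 1) t^2 - 2 k n t - k n^2 <= 0. *)
Require Import Defs.
From mathcomp Require Import all_boot all_order all_algebra.
From mathcomp Require Import polyrcf ring lra.
From mathcomp Require Import boolp reals filter topology normedtype sequences.

Set Implicit Arguments.
Unset Strict Implicit.
Unset Printing Implicit Defensive.

Import Order.TTheory GRing.Theory Num.Theory.

Local Open Scope ring_scope.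

(** * Frobenius norms and compressions to orthonormal rows *)

Lemma mxtrace_mul_tr (R : comPzRingType) m n (M : 'M[R]_(m, n)) :
  \tr (M *m M^T) = \sum_i \sum_j M i j ^+ 2.
Proof.
apply: eq_bigr => i _; rewrite mxE; apply: eq_bigr => j _.
by rewrite mxE expr2.
Qed.

Lemma mxtrace_mul_tr_ge0 (R : realDomainType) m n (M : 'M[R]_(m, n)) :
  0 <= \tr (M *m M^T).
Proof.
by rewrite mxtrace_mul_tr sumr_ge0 // => i _; rewrite sumr_ge0 // => j _; exact: sqr_ge0.
Qed.

Lemma mxtrace_mul_tr_eq0 (R : realDomainType) m n (M : 'M[R]_(m, n)) :
  \tr (M *m M^T) = 0 -> M = 0.
Proof.
move=> M0; apply/matrixP => i j; rewrite mxE; apply/eqP; rewrite -sqrf_eq0.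
move/eqP: M0; rewrite mxtrace_mul_tr psumr_eq0; last first.
  by move=> k _; rewrite sumr_ge0 // => l _; exact: sqr_ge0.
move=> /allP/(_ i (mem_index_enum _))/=.
rewrite psumr_eq0; last by move=> l _; exact: sqr_ge0.
by move=> /allP/(_ j (mem_index_enum _)).
Qed.

Lemma diag_compression (R : comPzRingType) m n (U : 'M[R]_(m, n)) (A : 'M[R]_n) i :
  (U *m A *m U^T) i i = \tr (row i U *m A *m (row i U)^T).
Proof.
rewrite -!row_mul /mxtrace big_ord1 !mxE; apply: eq_bigr => j _.
by rewrite !mxE.
Qed.

(** [U^T *m U] is an orthogonal projection, so the difference of the two sides is the squared
    Frobenius norm of [M - U^T *m U *m M]. *)
Lemma orthonormal_mulmx_le (R : realDomainType) m n p (U : 'M[R]_(m, n))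
    (M : 'M[R]_(n, p)) :
  U *m U^T = 1%:M -> \tr (U *m M *m (U *m M)^T) <= \tr (M *m M^T).
Proof.
move=> U1; rewrite -subr_ge0.
suff <- : \tr ((M - U^T *m U *m M) *m (M - U^T *m U *m M)^T) =
    \tr (M *m M^T) - \tr (U *m M *m (U *m M)^T).
  exact: mxtrace_mul_tr_ge0.
have -> : \tr (U *m M *m (U *m M)^T) = \tr (U^T *m U *m M *m M^T).
  by rewrite trmx_mul mulmxA mxtrace_mulC !mulmxA.
rewrite -raddfB -mulmxBl linearB /= mulmxBr raddfB /= [X in _ - X](_ : _ = 0) ?subr0 //.
rewrite !trmx_mul trmxK mulmxBl raddfB /= [X in X - _]mxtrace_mulC.
rewrite [X in _ - X]mxtrace_mulC -!mulmxA (mulmxA U U^T) U1 mul1mx.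
exact: subrr.
Qed.

(** Projecting on the left and, after transposition, on the right does not increase the Frobenius
    norm; the diagonal is only part of the compressed matrix. *)
Lemma compression_diag_le (R : realDomainType) m n (U : 'M[R]_(m, n)) (A : 'M[R]_n) :
  U *m U^T = 1%:M -> \sum_i ((U *m A *m U^T) i i) ^+ 2 <= \tr (A *m A^T).
Proof.
move=> U1; apply: (@le_trans _ _ (\tr (U *m A *m U^T *m (U *m A *m U^T)^T))).
  rewrite mxtrace_mul_tr ler_sum // => i _.
  by rewrite (bigD1 i) //= lerDl sumr_ge0 // => j _; exact: sqr_ge0.
rewrite -(mulmxA U A); apply: le_trans (orthonormal_mulmx_le (A *m U^T) U1) _.
rewrite mxtrace_mulC trmx_mul trmxK -[X in _ *m X]trmxK trmx_mul trmxK.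
apply: le_trans (orthonormal_mulmx_le A^T U1) _.
by rewrite trmxK mxtrace_mulC.
Qed.

Lemma orthonormal_col_mx (R : pzRingType) m1 m2 n (U : 'M[R]_(m1, n)) (V : 'M[R]_(m2, n)) :
  U *m U^T = 1%:M -> V *m V^T = 1%:M -> V *m U^T = 0 -> U *m V^T = 0 ->
  col_mx U V *m (col_mx U V)^T = 1%:M.
Proof.
by move=> U1 V1 VU UV; rewrite tr_col_mx mul_col_row U1 V1 VU UV -scalar_mx_block.
Qed.

Lemma mulmx_tr0C (R : comPzRingType) m1 m2 n (U : 'M[R]_(m1, n)) (V : 'M[R]_(m2, n)) :
  V *m U^T = 0 -> U *m V^T = 0.
Proof. by move/(congr1 trmx); rewrite trmx_mul trmxK trmx0. Qed.

(** * Completing orthonormal families *)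

Lemma normalize_row (R : rcfType) n (v : 'rV[R]_n) :
  v != 0 -> exists2 c : R, c != 0 & (c *: v) *m (c *: v)^T = 1%:M.
Proof.
move=> v0; have t0 : 0 < \tr (v *m v^T).
  rewrite lt_def mxtrace_mul_tr_ge0 andbT.
  by apply: contra v0 => /eqP/mxtrace_mul_tr_eq0 ->.
exists (Num.sqrt (\tr (v *m v^T)))^-1; first by rewrite invr_eq0 gt_eqF // sqrtr_gt0.
rewrite linearZ /= -scalemxAl -scalemxAr scalerA -invfM -expr2 sqr_sqrtr ?ltW //.
rewrite {2}[v *m v^T]mx11_scalar trace_mx11.
have := t0; rewrite trace_mx11 => t1.
by rewrite scale_scalar_mx mulVf // gt_eqF.
Qed.

(** Gram-Schmidt: by rank, some row of [W] lies outside [U]; subtract its projection, normalize,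
    append it to [U] and recurse. *)
Lemma orthonormal_extend (R : rcfType) m r p n (U : 'M[R]_(r, n)) (W : 'M[R]_(p, n)) :
  U *m U^T = 1%:M -> (U <= W)%MS -> (r + m <= \rank W)%N ->
  exists U' : 'M[R]_(m, n), [/\ U' *m U'^T = 1%:M, U' *m U^T = 0 & (U' <= W)%MS].
Proof.
elim: m r U => [|m IH] r U U1 UW rW.
  by exists 0; split; [apply/matrixP => -[] | apply/matrixP => -[] | exact: sub0mx].
have : ~~ (W <= U)%MS.
  apply/negP => /mxrankS WU; have := leq_trans WU (rank_leq_row U).
  by move=> /(leq_trans rW); rewrite addnS ltnNge leq_addr.
move=> /row_subPn[i wU]; set w := row i W in wU.
pose v := w - w *m U^T *m U.
have v0 : v != 0.
  apply: contra wU; rewrite subr_eq0 => /eqP ->; exact: submxMl.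
have vU : v *m U^T = 0 by rewrite mulmxBl -!mulmxA U1 mulmx1 subrr.
have [c c0 u1] := normalize_row v0; set u := c *: v in u1.
have uU : u *m U^T = 0 by rewrite -scalemxAl vU scaler0.
have uW : (u <= W)%MS.
  rewrite scalemx_sub // addmx_sub ?row_sub // eqmx_opp.
  exact: submx_trans (submxMl _ _) UW.
have [||| U' [U'1 U'U U'W]] := IH (r + 1)%N (col_mx U u).
- by apply: orthonormal_col_mx => //; exact: mulmx_tr0C.
- by rewrite col_mx_sub UW.
- by rewrite -addnA add1n.
move: U'U; rewrite tr_col_mx mul_mx_row -[0]hsubmxK => /eq_row_mx[].
rewrite !linear0 => U'U U'u.
have o1 := orthonormal_col_mx u1 U'1 U'u (mulmx_tr0C U'u).
have o2 : col_mx u U' *m U^T = 0 by rewrite mul_col_mx uU U'U col_mx0.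
have o3 : (col_mx u U' <= W)%MS by rewrite col_mx_sub uW.
by exists (col_mx u U').
Qed.

(** The square matrix [C] satisfies [C *m C^T = 1%:M], hence also [C^T *m C = 1%:M]. This makes the
    trace of a form on a subspace independent of the orthonormal basis. *)
Lemma orthonormal_projE (R : comUnitRingType) m n (U1 U2 : 'M[R]_(m, n)) :
  U1 *m U1^T = 1%:M -> U2 *m U2^T = 1%:M -> (exists C, U1 = C *m U2) ->
  U1^T *m U1 = U2^T *m U2.
Proof.
move=> o1 o2 [C def_U1]; have CC : C *m C^T = 1%:M.
  by rewrite -o1 def_U1 trmx_mul mulmxA -(mulmxA C) o2 mulmx1.
by rewrite def_U1 trmx_mul mulmxA -(mulmxA _ C^T) (mulmx1C CC) mulmx1.
Qed.

Lemma row_free_orthonormal (R : fieldType) m n (U : 'M[R]_(m, n)) :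
  U *m U^T = 1%:M -> row_free U.
Proof. by move=> U1; apply/row_freeP; exists U^T. Qed.

(** * Orthonormal eigenvectors of a symmetric matrix *)

Lemma char_poly_conj (R : comNzRingType) n (P Q B : 'M[R]_n) :
  P *m Q = 1%:M -> char_poly (P *m B *m Q) = char_poly B.
Proof.
move=> PQ; have mPQ : map_mx polyC P *m map_mx polyC Q = 1%:M.
  by rewrite -map_mxM PQ map_mx1.
rewrite /char_poly.
have -> : char_poly_mx (P *m B *m Q) =
    map_mx polyC P *m char_poly_mx B *m map_mx polyC Q.
  rewrite /char_poly_mx mulmxBr mulmxBl -!map_mxM; congr (_ - _).
  by rewrite -mulmxA -scalar_mxC mulmxA mPQ mul1mx.
by rewrite !det_mulmx mulrC mulrA -det_mulmx (mulmx1C mPQ) det1 mul1r.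
Qed.

Lemma unit_eigenvector (R : rcfType) n (B : 'M[R]_n) a :
  root (char_poly B) a ->
  exists2 x : 'rV[R]_n, x *m x^T = 1%:M & x *m B = a *: x.
Proof.
rewrite -eigenvalue_root_char => /eigenvalueP[v vB v0].
have [c c0 cv1] := normalize_row v0; exists (c *: v) => //.
by rewrite -scalemxAl vB !scalerA mulrC.
Qed.

(* Deflation: in an orthonormal basis starting with a unit eigenvector a
   symmetric matrix is block diagonal, and the characteristic polynomial of the
   remaining block loses exactly one factor. *)
Lemma symmetric_eigenvectors (R : rcfType) (s : seq R) n (B : 'M[R]_n) :
  B^T = B -> (forall a, (count_mem a s <= mup a (char_poly B))%N) ->
  exists2 Y : 'M[R]_(size s, n),
    Y *m Y^T = 1%:M & Y *m B = diag_mx (\row_(i < size s) s`_i) *m Y.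
Proof.
elim: s n B => [|a s IH] n B symB cs.
  by exists 0; apply/matrixP => -[].
have rt : root (char_poly B) a.
  by apply: contraT => /mupNroot ma; have := cs a; rewrite ma /= eqxx.
have [y y1 yB] := unit_eigenvector rt.
(* In dimension 0 the unit vector [y] would give 0 = 1 on taking traces. *)
case: n => [|n] in B symB cs rt y y1 yB *.
  have := congr1 mxtrace y1; rewrite (thinmx0 y) mul0mx mxtrace0 mxtrace1 => /eqP.
  by rewrite eq_sym oner_eq0.
have [U' [U'1 U'y _]] : exists U' : 'M[R]_(n, n.+1),
    [/\ U' *m U'^T = 1%:M, U' *m y^T = 0 & (U' <= (1%:M : 'M[R]_n.+1))%MS].
  by apply: orthonormal_extend; rewrite ?submx1 ?mxrank1.
pose O : 'M[R]_n.+1 := col_mx y U'.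
have OO : O *m O^T = 1%:M.
  exact: (orthonormal_col_mx y1 U'1 U'y (mulmx_tr0C U'y)).
have OTO : y^T *m y + U'^T *m U' = 1%:M.
  by rewrite -mul_row_col -tr_col_mx; exact: mulmx1C OO.
pose B' := U' *m B *m U'^T.
have symB' : B'^T = B' by rewrite /B' !trmx_mul trmxK symB mulmxA.
have By : B *m y^T = a *: y^T.
  by have := congr1 trmx yB; rewrite trmx_mul symB linearZ.
have U'B : U' *m B = B' *m U'.
  have U'By : U' *m B *m y^T = 0 by rewrite -mulmxA By -scalemxAr U'y scaler0.
  by rewrite -[LHS]mulmx1 -OTO mulmxDr mulmxA U'By mul0mx add0r mulmxA.
have OBO : col_mx y U' *m B *m (col_mx y U')^T = block_mx (a%:M : 'M_1) 0 0 B'.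
  rewrite tr_col_mx mul_col_mx mul_col_row yB -!scalemxAl y1.
  rewrite (mulmx_tr0C U'y) scaler0 -(mulmxA _ B y^T) By -scalemxAr U'y scaler0.
  by rewrite scale_scalar_mx mulr1.
have chB : char_poly B = ('X - a%:P) * char_poly B'.
  transitivity (char_poly (block_mx (a%:M : 'M_1) 0 0 B')).
    by rewrite -OBO; symmetry; exact: char_poly_conj OO.
  rewrite /char_poly char_block_diag_mx det_ublock; congr (_ * _).
  by rewrite /char_poly_mx map_scalar_mx -raddfB det_scalar1.
have [|Y' Y'1 Y'B] := IH n B' symB'.
  move=> b; have := cs b; rewrite chB mupM ?polyXsubC_eq0 ?monic_neq0 ?char_poly_monic //.
  have := mup_XsubCX 1 b a; rewrite expr1 => -> /=.
  by case: eqP => _; rewrite ?leq_add2l.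
have Z1 : Y' *m U' *m (Y' *m U')^T = 1%:M.
  by rewrite trmx_mul -mulmxA (mulmxA U') U'1 mul1mx.
have Zy : Y' *m U' *m y^T = 0 by rewrite -mulmxA U'y mulmx0.
exists (col_mx y (Y' *m U')).
  exact: (orthonormal_col_mx y1 Z1 Zy (mulmx_tr0C Zy)).
have Ds : diag_mx (\row_i (a :: s)`_i) =
    block_mx (a%:M : 'M_1) 0 0 (diag_mx (\row_(i < size s) s`_i)).
  transitivity (diag_mx (row_mx (a%:M : 'M_1) (\row_(i < size s) s`_i))).
    congr diag_mx; apply/rowP => i; rewrite !mxE; case: splitP => j ij; rewrite !mxE ij //.
    by rewrite !ord1 eqxx mulr1n.
  rewrite diag_mx_row; congr block_mx.
  by apply/matrixP => i j; rewrite !ord1 !mxE eqxx !mulr1n.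
rewrite Ds.
have ZB : col_mx y (Y' *m U') *m B =
    block_mx (a%:M : 'M_1) 0 0 (diag_mx (\row_(i < size s) s`_i)) *m col_mx y (Y' *m U').
  rewrite mul_col_mx yB -mulmxA U'B mulmxA Y'B -mulmxA.
  by rewrite mul_block_col !mul0mx addr0 add0r mul_scalar_mx.
exact: ZB.
Qed.

(** * Quadratic forms on spans of eigenvectors *)

Lemma eigenspace_form_ge (R : realDomainType) k n (B : 'M[R]_n) (Y : 'M[R]_(k, n))
    (d : 'rV[R]_k) mu m (V : 'M[R]_(m, n)) :
  Y *m Y^T = 1%:M -> Y *m B = diag_mx d *m Y -> (forall i, mu <= d 0 i) ->
  (exists C, V = C *m Y) -> mu * \tr (V *m V^T) <= \tr (V *m B *m V^T).
Proof.
move=> Y1 YB dmu [C ->]; have -> : C *m Y *m (C *m Y)^T = C *m C^T.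
  by rewrite trmx_mul mulmxA -(mulmxA C) Y1 mulmx1.
have -> : C *m Y *m B *m (C *m Y)^T = C *m diag_mx d *m C^T.
  by rewrite trmx_mul -(mulmxA C Y B) YB !mulmxA -(mulmxA _ Y Y^T) Y1 mulmx1.
rewrite mul_mx_diag mxtrace_mul_tr mulr_sumr.
rewrite /mxtrace ler_sum // => i _; rewrite mxE mulr_sumr ler_sum // => j _.
by rewrite !mxE expr2 mulrAC [leRHS]mulrC ler_wpM2r // -expr2 sqr_ge0.
Qed.

(* Projecting Y0 off the eigenvector x only decreases the form of A, and it
   is injective on Y0, since the form is positive at x. *)
Lemma orthogonal_negative_rows (R : rcfType) n m p (A : 'M[R]_n) (x : 'rV[R]_n)
    (Y0 : 'M[R]_(p, n)) lam mu :
  A^T = A -> x *m x^T = 1%:M -> x *m A = lam *: x -> 0 < lam + mu ->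
  (forall v : 'rV_n, (v <= Y0)%MS -> \tr (v *m A *m v^T) <= - mu * \tr (v *m v^T)) ->
  (m <= \rank Y0)%N ->
  exists W : 'M[R]_(m, n), [/\ W *m W^T = 1%:M, W *m x^T = 0,
    (W <= x + Y0)%MS & forall i, (W *m A *m W^T) i i <= - mu].
Proof.
move=> symA x1 xA lm neg rY0.
pose P : 'M[R]_n := 1%:M - x^T *m x.
have vP (v : 'rV_n) : v *m P = v - (v *m x^T) 0 0 *: x.
  by rewrite /P mulmxBr mulmx1 mulmxA {1}[v *m x^T]mx11_scalar mul_scalar_mx.
have Ax : A *m x^T = lam *: x^T.
  by have := congr1 trmx xA; rewrite trmx_mul symA linearZ.
have Px : P *m x^T = 0 by rewrite mulmxBl mul1mx -mulmxA x1 mulmx1 subrr.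
have trB (v : 'rV_n) c : (v - c *: x)^T = v^T - c *: x^T.
  by apply/matrixP => i j; rewrite !mxE.
have vv (v : 'rV_n) c : v *m x^T = c%:M ->
    \tr ((v - c *: x) *m (v - c *: x)^T) = \tr (v *m v^T) - c ^+ 2.
  move=> vx; have xv : x *m v^T = c%:M.
    by rewrite -[x]trmxK -trmx_mul vx tr_scalar_mx.
  rewrite trB mulmxBl !mulmxBr -!scalemxAl -!scalemxAr vx xv x1.
  rewrite !raddfB /= !linearZ /= !mxtrace_scalar; ring.
have vAv (v : 'rV_n) c : v *m x^T = c%:M ->
    \tr ((v - c *: x) *m A *m (v - c *: x)^T) = \tr (v *m A *m v^T) - lam * c ^+ 2.
  move=> vx; have xv : x *m v^T = c%:M.
    by rewrite -[x]trmxK -trmx_mul vx tr_scalar_mx.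
  rewrite trB mulmxBl -scalemxAl xA mulmxBl !mulmxBr -!scalemxAl -!scalemxAr.
  rewrite -(mulmxA v A x^T) Ax -!scalemxAr vx xv x1.
  rewrite !raddfB /= !linearZ /= !mxtrace_scalar; ring.
(* A vector of [Y0] killed by [P] is [c *: x], where the form of [A] is lam c^2; the bound on [Y0]
   then gives (lam + mu) c^2 <= 0, so c = 0. *)
have inj : \rank (Y0 :&: kermx P) = 0%N.
  apply/eqP; rewrite mxrank_eq0 -submx0; apply/rV_subP => v.
  rewrite sub_capmx => /andP[vY0 /sub_kermxP].
  rewrite vP => /eqP; rewrite subr_eq0 => /eqP vE.
  set c := (v *m x^T) 0 0 in vE; have := neg v vY0.
  rewrite vE linearZ /= -!scalemxAl -!scalemxAr xA -scalemxAl x1.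
  rewrite !linearZ /= mxtrace1 => le_c.
  have : (lam + mu) * c ^+ 2 <= 0 by move: le_c; lra.
  rewrite pmulr_rle0 // => c2; have : c ^+ 2 == 0 by rewrite eq_le c2 sqr_ge0.
  by rewrite sqrf_eq0 => /eqP ->; rewrite scale0r sub0mx.
have [|||W [W1 _ WP]] := @orthonormal_extend R m 0 p n 0 (Y0 *m P).
- by apply/matrixP => -[].
- exact: sub0mx.
- by rewrite add0n; have := mxrank_mul_ker Y0 P; rewrite inj addn0 => ->.
have W_row i : exists v : 'rV_n, [/\ (v <= Y0)%MS & row i W = v *m P].
  have /submxP[D WD] := WP; exists (row i D *m Y0); split; first exact: submxMl.
  by rewrite WD !row_mul -mulmxA.
exists W; split=> //.
- by have /submxP[D ->] := WP; rewrite -!mulmxA Px !mulmx0.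
- apply/row_subP => i; have [v [vY0 ->]] := W_row i.
  rewrite vP addmx_sub //; first exact: submx_trans vY0 (addsmxSr _ _).
  by rewrite eqmx_opp scalemx_sub // addsmxSl.
(* The row is v - c x with |v|^2 = 1 + c^2, so its form is at most -mu (1 + c^2) - lam c^2 = -mu -
   (lam + mu) c^2. *)
- move=> i; rewrite diag_compression; have [v [vY0 Wv]] := W_row i.
  have w1 : \tr (row i W *m (row i W)^T) = 1.
    by have := diag_compression W 1%:M i; rewrite !mulmx1 W1 mxE eqxx => <-.
  have vx := mx11_scalar (v *m x^T).
  move: w1; rewrite Wv vP (vv _ _ vx) (vAv _ _ vx).
  have := neg v vY0; set c := (v *m x^T) 0 0; have := sqr_ge0 c.
  set c2 := c ^+ 2; set q := \tr (v *m v^T) => c2_ge0 vAv_le q1.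
  have -> : - mu = - mu * (q - c2) by rewrite q1 mulr1.
  have : 0 <= (lam + mu) * c2 by rewrite mulr_ge0 // ltW.
  move: vAv_le; lra.
Qed.

(** * Combining two orthonormal bases of the same space *)

Lemma sum_diag_col_mx (R : comPzRingType) (F : R -> R) m1 m2 n (A : 'M[R]_n)
    (P : 'M[R]_(m1, n)) (Q : 'M[R]_(m2, n)) :
  \sum_i F ((col_mx P Q *m A *m (col_mx P Q)^T) i i) =
  \sum_i F ((P *m A *m P^T) i i) + \sum_i F ((Q *m A *m Q^T) i i).
Proof.
rewrite big_split_ord /= tr_col_mx mul_col_mx mul_col_row.
by congr (_ + _); apply: eq_bigr => i _; rewrite ?block_mxEul ?block_mxEdr.
Qed.

(** [S] and [SA] stand for the sum and the sum of squares of the K entries <= -mu, [T] and [TB] for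
    those of the K + 1 entries >= mu. Equality pushes [a] and [nu] to -(lam + mu - N) / 2. *)
Lemma spread_inequality (R : realFieldType) (lam mu S a T nu N K SA TB : R) :
  - 2 * mu * S - K * mu ^+ 2 <= SA -> 2 * mu * T - (K + 1) * mu ^+ 2 <= TB ->
  S <= - K * mu -> (K + 1) * mu <= T ->
  lam + S + a + T + nu <= N -> lam ^+ 2 + SA + a ^+ 2 + TB + nu ^+ 2 <= N ^+ 2 ->
  0 <= lam + mu - N -> lam + mu - N <= mu ->
  lam ^+ 2 + (2 * K + 1) * mu ^+ 2 + (lam + mu - N) ^+ 2 / 2 <= N ^+ 2.
Proof.
move=> hSA hTB hS hT tr sq d0 dmu; set de := lam + mu - N in d0 dmu *.
(* The multipliers are nonnegative because 0 <= de <= mu. Adding [sq], [hSA], [hTB], [hE], [hF],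
   [hz] and half of [h1] and [h2] yields the goal. *)
have hE : 0 <= (2 * mu - de) * (- S - K * mu) by apply: mulr_ge0; lra.
have hF : 0 <= (2 * mu + de) * (T - (K + 1) * mu) by apply: mulr_ge0; lra.
have hz : 0 <= de * (N - lam - S - T - (a + nu)) by apply: mulr_ge0; lra.
have h1 : 0 <= (a - nu) ^+ 2 by exact: sqr_ge0.
have h2 : 0 <= (a + nu + de) ^+ 2 by exact: sqr_ge0.
have -> : N = lam + mu - de by rewrite /de; ring.
move: sq hz; have -> : N = lam + mu - de by rewrite /de; ring.
move: de hE hF h2 {d0 dmu tr hS hT} => de.
nra.
Qed.

(** Here [k] is one less than the eigenvalue index, so 2k + 1 is the overview's 2k - 1; [e] plays
    the all-one vector. The bases of V are [U1], adapted to [A], and [U2], adapted to [B]. *)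
Lemma two_basis_bound (R : rcfType) n k (A B : 'M[R]_n) lam mu (x : 'rV[R]_n)
    (Y : 'M[R]_(k.+1, n)) (d : 'rV[R]_k.+1) (e : 'rV[R]_n) N :
  A^T = A -> B^T = B -> A + B = e^T *m e - 1%:M -> \tr (e *m e^T) = N ->
  \tr (A *m A^T) + \tr (B *m B^T) <= N ^+ 2 ->
  x *m x^T = 1%:M -> x *m A = lam *: x ->
  Y *m Y^T = 1%:M -> Y *m B = diag_mx d *m Y -> (forall i, mu <= d 0 i) ->
  lam <= N -> N < lam + mu ->
  lam ^+ 2 + (2 * k%:R + 1) * mu ^+ 2 + (lam + mu - N) ^+ 2 / 2 <= N ^+ 2.
Proof.
move=> symA symB AB eN AABB x1 xA Y1 YB dmu lamN Nlm.
(* On an orthonormal frame, [e^T *m e] has trace |U e^T|^2 <= |e|^2 = N. *)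
have form_le m (U : 'M_(m, n)) : U *m U^T = 1%:M ->
    \tr (U *m A *m U^T) + \tr (U *m B *m U^T) <= N - m%:R.
  move=> U1; rewrite -raddfD -mulmxDl -mulmxDr AB mulmxBr mulmx1 mulmxBl U1.
  rewrite raddfB /= mxtrace1 lerB // -eN (mxtrace_mulC e) -[X in _ <= \tr (_ *m X)]trmxK.
  have -> : U *m (e^T *m e) *m U^T = U *m e^T *m (U *m e^T)^T.
    by rewrite trmx_mul trmxK !mulmxA.
  exact: orthonormal_mulmx_le.
(* Otherwise testing both forms on [x] gives lam + mu <= N - 1. *)
have xY : ~~ (x <= Y)%MS.
  apply/negP => /submxP xY.
  have := eigenspace_form_ge Y1 YB dmu xY; rewrite x1 mxtrace1 mulr1.
  have := form_le _ _ x1; rewrite xA -scalemxAl x1 linearZ /= mxtrace1 mulr1.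
  lra.
have rY : \rank Y = k.+1 by apply/eqP; exact: row_free_orthonormal Y1.
have YYx : (Y < Y + x)%MS by rewrite /ltmx addsmxSl addsmx_sub submx_refl.
have [||g [g1 gY gYx]] := @orthonormal_extend R 1 _ _ n Y (Y + x)%MS Y1.
- exact: addsmxSl.
- by rewrite addn1 -{1}rY; exact: rank_ltmx.
pose U2 := col_mx Y g.
have U21 : U2 *m U2^T = 1%:M by apply: orthonormal_col_mx => //; exact: mulmx_tr0C.
have rU2 : \rank U2 = (k.+1 + 1)%N by apply/eqP; exact: row_free_orthonormal U21.
have U2Yx : (U2 <= Y + x)%MS by rewrite col_mx_sub addsmxSl.
(* [Y + x] has rank at most k + 2, which [U2] already attains. *)
have YxU2 : (Y + x <= U2)%MS.
  rewrite -(geq_leqif (mxrank_leqif_sup U2Yx)) rU2.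
  apply: leq_trans (mxrank_adds_leqif Y x) _.
  by rewrite rY leq_add2l rank_leq_row.
have YU2 : (Y <= U2)%MS := submx_trans (addsmxSl Y x) YxU2.
have xU2 : (x <= U2)%MS := submx_trans (addsmxSr Y x) YxU2.
pose Y0 := (Y :&: kermx e^T)%MS.
(* Orthogonality to [e] is one linear condition, costing at most one dimension. *)
have rY0 : (k <= \rank Y0)%N.
  have := mxrank_mul_ker Y e^T; rewrite rY -/Y0 => rk.
  by rewrite -(leq_add2l 1) add1n -rk leq_add2r rank_leq_col.
have negA (v : 'rV_n) : (v <= Y0)%MS ->
    \tr (v *m A *m v^T) <= - mu * \tr (v *m v^T).
  rewrite sub_capmx => /andP[/submxP vY /sub_kermxP ve].
  have := eigenspace_form_ge Y1 YB dmu vY.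
  have : v *m A + v *m B = - v.
    by rewrite -mulmxDr AB mulmxBr mulmxA ve mul0mx mulmx1 sub0r.
  move/(congr1 (fun w => \tr (w *m v^T))); rewrite mulmxDl mulNmx raddfD raddfN /=.
  have := mxtrace_mul_tr_ge0 v; lra.
have lm0 : 0 < lam + mu.
  by apply: le_lt_trans Nlm; rewrite -eN mxtrace_mul_tr_ge0.
have [W [W1 Wx WxY AW]] := orthogonal_negative_rows symA x1 xA lm0 negA rY0.
have WU2 : (W <= U2)%MS.
  apply: submx_trans WxY _; rewrite addsmx_sub xU2.
  exact: submx_trans (capmxSl _ _) YU2.
have xW1 : col_mx x W *m (col_mx x W)^T = 1%:M.
  by apply: orthonormal_col_mx => //; exact: mulmx_tr0C.
have [||h [h1 hxW hU2]] := @orthonormal_extend R 1 _ _ n (col_mx x W) U2 xW1.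
- by rewrite col_mx_sub xU2.
- by rewrite rU2.
pose U1 := col_mx (col_mx x W) h.
have U11 : U1 *m U1^T = 1%:M by apply: orthonormal_col_mx => //; exact: mulmx_tr0C.
have U1U2 : (U1 <= U2)%MS by rewrite !col_mx_sub xU2 WU2.
have trA : \tr (U1 *m A *m U1^T) = \tr (U2 *m A *m U2^T).
  rewrite -!mulmxA ![\tr (_ *m (A *m _))]mxtrace_mulC -!mulmxA.
  congr (\tr (A *m _)); apply: (@orthonormal_projE _ (k.+1 + 1)) => //.
  exact/submxP.
have tr_le := form_le _ _ U21; rewrite -trA in tr_le.
have sqA := compression_diag_le A U11; have sqB := compression_diag_le B U21.
move: tr_le sqA sqB; rewrite {1 2}/mxtrace !(sum_diag_col_mx (fun t => t)).
rewrite !(sum_diag_col_mx (fun t => t ^+ 2)) !big_ord1.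
have -> : (x *m A *m x^T) 0 0 = lam by rewrite xA -scalemxAl x1 !mxE mulr1.
set a := (h *m A *m h^T) 0 0; set nu := (g *m B *m g^T) 0 0.
have muY i : mu <= (Y *m B *m Y^T) i i.
  by rewrite YB -mulmxA Y1 mulmx1 mxE eqxx mulr1n.
set S := \sum_i (W *m A *m W^T) i i; set T := \sum_i (Y *m B *m Y^T) i i.
set SA := \sum_i _ ^+ 2; set TB := \sum_i _ ^+ 2 => tr_le sqA sqB.
have sum_cst m (c : R) : m%:R * c = \sum_(i < m) c.
  by rewrite sumr_const card_ord mulr_natl.
(* The bounds on [SA] and [TB] sum the tangent-line inequality s^2 >= 2 c s - c^2, with c = -mu for
   [A] and c = mu for [B]. *)
apply: (@spread_inequality R lam mu S a T nu N k%:R SA TB).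
- rewrite /SA /S mulr_sumr (sum_cst _ (mu ^+ 2)) -sumrB ler_sum // => i _.
  have := sqr_ge0 ((W *m A *m W^T) i i + mu); lra.
- rewrite natr1 /TB /T mulr_sumr (sum_cst _ (mu ^+ 2)) -sumrB ler_sum // => i _.
  have := sqr_ge0 ((Y *m B *m Y^T) i i - mu); lra.
- by rewrite mulNr -mulrN sum_cst ler_sum.
- by rewrite natr1 sum_cst ler_sum.
- have := ler0n R (k.+1 + 1); lra.
- lra.
- lra.
- lra.
Qed.

Lemma quadratic_bound (R : rcfType) (K lam mu N : R) :
  1 <= K -> 0 <= N ->
  lam ^+ 2 + (2 * K - 1) * mu ^+ 2 + (lam + mu - N) ^+ 2 / 2 <= N ^+ 2 ->
  lam + mu <= (K + Num.sqrt (K * (4 * K - 1))) / (3 * K - 1) * N.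
Proof.
move=> K1 N0 le_N; set t := lam + mu.
have c0 : 0 < 3 * K - 1 by lra.
rewrite mulrAC ler_pdivlMr //.
set q := K * (4 * K - 1); suff : (3 * K - 1) * t - K * N <= Num.sqrt q * N by lra.
have q0 : 0 <= q by apply: mulr_ge0; lra.
(* Weighted Cauchy-Schwarz: (2K - 1) t^2 <= 2K (lam^2 + (2K - 1) mu^2), with defect the square of
   lam - (2K - 1) mu. *)
have quad : (3 * K - 1) * t ^+ 2 - 2 * K * N * t - K * N ^+ 2 <= 0.
  have := sqr_ge0 (lam - (2 * K - 1) * mu).
  have : 0 <= 2 * K *
      (N ^+ 2 - (lam ^+ 2 + (2 * K - 1) * mu ^+ 2 + (lam + mu - N) ^+ 2 / 2)).
    by apply: mulr_ge0; lra.
  rewrite /t; lra.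
(* Completing the square in [quad]: ((3K - 1) t - K N)^2 <= (K^2 + K (3K - 1)) N^2 = q N^2. *)
apply: le_trans (ler_norm _) _.
rewrite -[leRHS]ger0_norm ?mulr_ge0 ?sqrtr_ge0 // -ler_sqr ?qualifE //=.
rewrite !real_normK ?num_real //.
rewrite exprMn sqr_sqrtr // /q.
have : (3 * K - 1) * ((3 * K - 1) * t ^+ 2 - 2 * K * N * t - K * N ^+ 2) <= 0.
  by rewrite pmulr_rle0.
lra.
Qed.

(** * The sorted list of eigenvalues *)

Lemma count_flatten_nseq (T : eqType) (m : T -> nat) (r : seq T) a :
  uniq r -> (count_mem a (flatten [seq nseq (m x) x | x <- r]) <= m a)%N.
Proof.
elim: r => //= x r IH /andP[xr /IH {}IH]; rewrite count_cat count_nseq /=.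
have [<-|xa] := eqVneq x a; last by rewrite mul0n.
rewrite mul1n -[leqRHS]addn0 leq_add2l leqn0 -leqn0 leqNgt -has_count.
apply/hasP => -[y /flattenP[_ /mapP[z zr ->]]].
by rewrite mem_nseq => /andP[_ /eqP ->] /eqP zx; rewrite -zx zr in xr.
Qed.

Lemma count_eigenvalues (R : realType) n (A : 'M[R]_n) a :
  (count_mem a (eigenvalues A) <= mup a (char_poly A))%N.
Proof.
rewrite /eigenvalues (permP (permEl (perm_sort _ _))).
by apply: count_flatten_nseq; exact: uniq_roots.
Qed.

Lemma root_eigenvalues (R : realType) n (A : 'M[R]_n) a :
  a \in eigenvalues A -> root (char_poly A) a.
Proof.
rewrite -has_pred1 has_count => c0.
by apply: contraT => /mupNroot m0; have := leq_trans c0 (count_eigenvalues A a); rewrite m0.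
Qed.

(** A prefix of the eigenvalue list respects the multiplicities, so it is realized by orthonormal
    eigenvectors; sortedness makes its last entry, at 0-based position [k], the least. *)
Lemma eigenvectors_of_top_eigenvalues (R : realType) n (B : 'M[R]_n) k :
  B^T = B -> (k < size (eigenvalues B))%N ->
  exists (Y : 'M[R]_(k.+1, n)) (d : 'rV[R]_k.+1),
    [/\ Y *m Y^T = 1%:M, Y *m B = diag_mx d *m Y &
        forall i, nth 0 (eigenvalues B) k <= d 0 i].
Proof.
move=> symB kB; set L := eigenvalues B in kB *.
have [a|] := @symmetric_eigenvectors R (take k.+1 L) n B symB.
  apply: leq_trans (count_eigenvalues B a).
  by rewrite -/L -{2}(cat_take_drop k.+1 L) count_cat leq_addr.
have sz : size (take k.+1 L) = k.+1 by rewrite size_takel.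
move: sz; set s := take _ _; have sE i : (i <= k)%N -> s`_i = L`_i.
  by move=> ik; rewrite nth_take.
move: (s) sE => {}s sE sz; rewrite sz => Y Y1 YB; exists Y, (\row_i s`_i); split=> // i.
rewrite mxE sE; last by rewrite -ltnS.
have : sorted (fun x y : R => y <= x) L by apply: sort_sorted => a b; exact: le_total.
move: {s sE sz Y Y1 YB} L kB => L kB srt.
apply: (sorted_leq_nth _ _ _ srt) => //.
- by move=> a b c ba ac; exact: le_trans ac ba.
- by rewrite inE (leq_trans (ltn_ord i)).
- by rewrite -ltnS.
Qed.

(** * Adjacency matrices of a graph and its complement *)

Lemma adjmx_sym (R : realType) n (G : sgraph n) : (adjmx R G)^T = adjmx R G.
Proof. by apply/matrixP => i j; rewrite !mxE finset.setUC. Qed.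

Lemma adjmx_compl (R : realType) n (G : sgraph n) :
  adjmx R G + adjmx R (compl G) = (const_mx 1 : 'rV[R]_n)^T *m const_mx 1 - 1%:M.
Proof.
apply/matrixP => i j; rewrite !mxE big_ord1 !mxE mulr1 !inE cards2.
have [<-|ij] := eqVneq i j; last first.
  by rewrite subr0 andbT; case: (_ \in _); rewrite ?addr0 ?add0r.
rewrite andbF addr0 subrr; case: G => E /= /forall_inP E2.
by case: (boolP (_ \in E)) => // /E2; rewrite cards2 eqxx.
Qed.

(** At each position at most one of the two 0/1 matrices has entry 1. *)
Lemma frobenius_compl_le (R : realType) n (G : sgraph n) :
  \tr (adjmx R G *m (adjmx R G)^T) +
  \tr (adjmx R (compl G) *m (adjmx R (compl G))^T) <= n%:R ^+ 2.
Proof.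
rewrite !mxtrace_mul_tr -big_split /=.
apply: (@le_trans _ _ (\sum_(i < n) \sum_(j < n) 1)).
  apply: ler_sum => i _; rewrite -big_split; apply: ler_sum => j _.
  rewrite !mxE !inE; case: (_ \in _) => /=; rewrite ?expr1n ?expr0n ?addr0 //.
  by rewrite add0r; case: (_ == _); rewrite ?expr1n ?expr0n.
by rewrite !sumr_const !card_ord -mulrnA natrM expr2.
Qed.

(** Compressing [A] to a unit eigenvector gives the 1 by 1 matrix with entry [a]. *)
Lemma root_le_frobenius (R : rcfType) n (A : 'M[R]_n) a N :
  0 <= N -> \tr (A *m A^T) <= N ^+ 2 -> root (char_poly A) a -> a <= N.
Proof.
move=> N0 AN /unit_eigenvector[x x1 xA].
have := le_trans (compression_diag_le A x1) AN.
rewrite big_ord1 xA -scalemxAl x1 !mxE mulr1 => aN.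
apply: le_trans (ler_norm a) _; rewrite -[N]ger0_norm //.
by rewrite -ler_sqr ?qualifE //= !real_normK ?num_real.
Qed.

Lemma lambda_sum_le (R : realType) n k (G : sgraph n) :
  lambda R 1 G + lambda R k.+1 (compl G) <=
  (k.+1%:R + Num.sqrt (k.+1%:R * (4 * k.+1%:R - 1))) / (3 * k.+1%:R - 1) * n%:R.
Proof.
set c := _ / _; have N0 : 0 <= n%:R :> R by exact: ler0n.
have K1 : 1 <= k.+1%:R :> R by rewrite ler1n.
have [|lt_N] := leP (lambda R 1 G + lambda R k.+1 (compl G)) n%:R.
  move=> le_N; apply: le_trans le_N _; rewrite -[leLHS]add0r.
  (* Taking lam = n and mu = 0 shows n <= c n, which settles the case of a sum at most n. *)
  have := @quadratic_bound R k.+1%:R n%:R 0 n%:R K1 N0.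
  by rewrite add0r addr0 -/c; apply; lra.
have AABB := frobenius_compl_le R G.
have AA : \tr (adjmx R G *m (adjmx R G)^T) <= n%:R ^+ 2.
  by apply: le_trans AABB; rewrite lerDl mxtrace_mul_tr_ge0.
have BB : \tr (adjmx R (compl G) *m (adjmx R (compl G))^T) <= n%:R ^+ 2.
  by apply: le_trans AABB; rewrite lerDr mxtrace_mul_tr_ge0.
have le_N (H : sgraph n) i : \tr (adjmx R H *m (adjmx R H)^T) <= n%:R ^+ 2 ->
    lambda R i H <= n%:R.
  move=> HN; rewrite /lambda; have [iH|iH] := ltnP i.-1 (size (eigenvalues (adjmx R H))).
    by apply: root_le_frobenius HN _ => //; apply/root_eigenvalues/mem_nth.
  by rewrite nth_default.
(* If an eigenvalue list is too short, that [lambda] is the default 0 and the other is at most n,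
   against [lt_N]. *)
have [kB|kB] := ltnP k (size (eigenvalues (adjmx R (compl G)))); last first.
  have := le_N G 1%N AA; move: lt_N.
  by rewrite {2}/lambda nth_default // addr0 ltNge => /negbTE ->.
have [kA|kA] := ltnP 0 (size (eigenvalues (adjmx R G))); last first.
  have := le_N (compl G) k.+1 BB; move: lt_N.
  by rewrite {1}/lambda nth_default // add0r ltNge => /negbTE ->.
have [Y [d [Y1 YB dmu]]] := eigenvectors_of_top_eigenvalues (adjmx_sym R (compl G)) kB.
have [x x1 xA] := unit_eigenvector (root_eigenvalues (mem_nth 0 kA)).
apply: quadratic_bound => //.
rewrite (_ : 2 * k.+1%:R - 1 = 2 * k%:R + 1); last by rewrite -natr1; ring.
apply: (two_basis_bound (adjmx_sym R G) (adjmx_sym R (compl G)) (adjmx_compl R G) _ AABB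
  x1 xA Y1 YB dmu _ lt_N).
  rewrite mxtrace_mul_tr big_ord1 (eq_bigr (fun=> 1)) ?sumr_const ?card_ord //.
  by move=> j _; rewrite !mxE expr1n.
exact: (le_N G 1%N).
Qed.

(** * Passage to the limit *)

Section Limit.
Import numFieldNormedType.Exports.

(* [lim] of a divergent sequence is the junk value 0: hence the hypothesis on c. *)
Lemma limn_le_bound (R : realType) (u : nat -> R) c :
  0 <= c -> (forall n, u n <= c) -> limn u <= c.
Proof.
move=> c0 uc; have [cu|/dvgP->//] := pselect (cvgn u).
by apply: limr_le => //; near=> n.
Unshelve. all: by end_near.
Qed.

End Limit.

Unset Implicit Arguments.

Theorem theorem4 (R : realType) (k : nat) (hk : (2 <= k)%N) :
  alpha R 1 k <=
    (k%:R + Num.sqrt (k%:R * (4 * k%:R - 1))) / (3 * k%:R - 1).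
Proof.
case: k hk => // k _.
have K1 : 1 <= k.+1%:R :> R by rewrite ler1n.
have c0 : 0 <= (k.+1%:R + Num.sqrt (k.+1%:R * (4 * k.+1%:R - 1))) / (3 * k.+1%:R - 1) :> R.
  by apply: divr_ge0; [rewrite addr_ge0 ?sqrtr_ge0 // | ]; lra.
(* At n = 0 the inverse is 0 by convention, so the term is 0. *)
apply: limn_le_bound => // -[|n]; first by rewrite invr0 mul0r.
rewrite mulrC ler_pdivrMr ?ltr0n //.
by apply: bigmax_le => [|G _]; exact: lambda_sum_le.
Qed.
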